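(* Let $G$ be a free abelian group. Then: (a) $s(G)=ns(G)$; (b) $s(G)=0$ if and only if $r_0(G)\leq 1$; (c) $s_0(G)=0$ if and only if $r_0(G)$ is finite.
   Context: $\mathbb N=\{0,1,2,\dots\}$ and $\mathbb N_+=\mathbb N\setminus\{0\}$. Let $\phi$ be an endomorphism of an abelian group $G$. A string of $\phi$ is a sequence $S=\{x_n\}_{n\in\mathbb N}$ of pairwise distinct elements of $G$ such that $\phi(x_n)=x_{n-1}$ for every $n\in\mathbb N_+$. A string is singular if $\phi^j(x_0)=\phi^k(x_0)$ for some $j\neq k$ in $\mathbb N$, and non-singular otherwise; it is a null string if $x_0\neq 0$ and $\phi^k(x_0)=0$ for some $k\in\mathbb N_+$. Define $s(\phi)$ (respectively $ns(\phi)$, $s_0(\phi)$) as the supremum of the cardinalities $|\mathcal F|$, where $\mathcal F$ ranges over the families of pairwise disjoint strings (respectively non-singular strings, null strings) of $\phi$; if this supremum is infinite it is set equal to the symbol $\infty$. For an abelian group $G$, $s(G)=\sup\{s(\phi):\phi\in\mathrm{End}(G)\}$, $ns(G)=\sup\{ns(\phi):\phi\in\mathrm{End}(G)\}$, $s_0(G)=\sup\{s_0(\phi):\phi\in\mathrm{End}(G)\}$. $r_0(G)$ denotes the torsion-free rank of $G$. *)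

(* Defs.v *)
From mathcomp Require Import all_boot all_order all_algebra.
From mathcomp Require Import finmap.
From mathcomp Require Import all_classical all_reals all_analysis.

Set Implicit Arguments.
Unset Strict Implicit.
Unset Printing Implicit Defensive.

Import Order.TTheory GRing.Theory Num.Theory.

Local Open Scope classical_set_scope.
Local Open Scope ring_scope.

(* Values in N u {oo} are taken in the extended reals \bar R: [counting] sends
   a finite set to its cardinality and an infinite one to +oo, and each
   supremum below is over a set of values of [counting] that contains 0, or
   over a nonempty set of such suprema. *)

Definition z_independent (G : zmodType) (B : set G) : Prop :=
  forall (A : {fset G}) (c : G -> int), [set` A] `<=` B ->
    \sum_(x <- A) x *~ c x = 0 -> forall x, x \in A -> c x = 0.

Definition z_generating (G : zmodType) (B : set G) : Prop :=
  forall y : G, exists (A : {fset G}) (c : G -> int),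
    [set` A] `<=` B /\ y = \sum_(x <- A) x *~ c x.

Definition free_abelian (G : zmodType) : Prop :=
  exists B : set G, z_independent B /\ z_generating B.

(* The largest cardinality of an independent subset. *)
Definition torsion_free_rank (R : realType) (G : zmodType) : \bar R :=
  ereal_sup [set counting B | B in @z_independent G].

Definition is_string (G : zmodType) (phi : {additive G -> G}) (S : nat -> G)
    : Prop :=
  injective S /\ forall n, phi (S n.+1) = S n.

Definition is_singular_string (G : zmodType) (phi : {additive G -> G})
    (S : nat -> G) : Prop :=
  is_string phi S /\
  exists j k : nat, j <> k /\ iter j phi (S 0%N) = iter k phi (S 0%N).

Definition is_nonsingular_string (G : zmodType) (phi : {additive G -> G})
    (S : nat -> G) : Prop :=
  is_string phi S /\ ~ is_singular_string phi S.

Definition is_null_string (G : zmodType) (phi : {additive G -> G})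
    (S : nat -> G) : Prop :=
  [/\ is_string phi S, S 0%N <> 0
    & exists k : nat, (0 < k)%N /\ iter k phi (S 0%N) = 0].

(* Disjointness of strings refers to their sets of terms; since these are
   nonempty, [trivIset F range] says that distinct members of F are disjoint. *)
Definition disjoint_family (G : zmodType) (P : set (nat -> G)) :
    set (set (nat -> G)) :=
  [set F | F `<=` P /\ trivIset F (fun S => range S)].

Definition s_end (R : realType) (G : zmodType) (phi : {additive G -> G})
    : \bar R :=
  ereal_sup [set counting F | F in disjoint_family (is_string phi)].

Definition ns_end (R : realType) (G : zmodType) (phi : {additive G -> G})
    : \bar R :=
  ereal_sup [set counting F | F in disjoint_family (is_nonsingular_string phi)].

Definition s0_end (R : realType) (G : zmodType) (phi : {additive G -> G})
    : \bar R :=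
  ereal_sup [set counting F | F in disjoint_family (is_null_string phi)].

Definition s_group (R : realType) (G : zmodType) : \bar R :=
  ereal_sup [set s_end R phi | phi in [set: {additive G -> G}]].

Definition ns_group (R : realType) (G : zmodType) : \bar R :=
  ereal_sup [set ns_end R phi | phi in [set: {additive G -> G}]].

Definition s0_group (R : realType) (G : zmodType) : \bar R :=
  ereal_sup [set s0_end R phi | phi in [set: {additive G -> G}]].

(* Main.v *)
From HB Require Import structures.
Require Import Defs.
From mathcomp Require Import all_boot all_order all_algebra.
From mathcomp Require Import finmap.
From mathcomp Require Import all_classical all_reals all_analysis.

Set Implicit Arguments.
Unset Strict Implicit.
Unset Printing Implicit Defensive.

Import Order.TTheory GRing.Theory Num.Theory.

Local Open Scope classical_set_scope.
Local Open Scope ring_scope.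

(** Both (b) and (c) become statements about a basis B, because the torsion-free
    rank is the cardinality of any basis: integer linear algebra bounds an
    independent set by the size of a finite basis ([torsion_free_rank_basis]).

    If B has at most one element, then every endomorphism is multiplication by
    an integer m on a cyclic torsion-free group.  A string would be a sequence
    of distinct integers c_n with c_n = m c_(n+1), hence with non-increasing
    absolute values, and there is no such sequence ([cyclic_no_string]).  So
    s and ns both vanish.  If B contains two elements e and f, the shear fixing
    every basis element except f, which it sends to f + e, has infinitely many
    disjoint infinite orbits; these are non-singular strings, and s and ns are
    both infinite ([shear_strings]).  This gives (a) and (b).

    For (c), an infinite basis contains a sequence e_0, e_1, ..., and the
    backward shift along it has e as a null string ([infinite_basis_shift]).
    Conversely, applying a suitable power of phi to a null string gives a
    sequence z with z_0 <> 0, phi z_0 = 0 and phi z_(n+1) = z_n.  Its terms are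
    independent, because phi^n kills z_i for i < n and maps z_n to z_0, so the
    rank is infinite ([null_string_independent]). *)

(** * Linear algebra over the integers *)

(** Over the Smith normal form of a tall matrix this is clear, since the bottom
    row of a tall diagonal matrix vanishes; working over the integers avoids
    clearing the denominators of a rational solution. *)
Lemma int_left_kernel (m n : nat) (M : 'M[int]_(m, n)) :
  (n < m)%N -> exists2 u : 'rV[int]_m, u != 0 & u *m M = 0.
Proof.
move=> ltnm; have [L Lunit [R Runit [d _ ->]]] := int_Smith_normal_form M.
have i0P : (m.-1 < m)%N by rewrite ltn_predL; exact: leq_ltn_trans ltnm.
pose i0 := Ordinal i0P.
exists (row i0 (invmx L)).
  apply/eqP => r0.
  have : row i0 (invmx L) *m L = 0 by rewrite r0 mul0mx.
  rewrite -row_mul mulVmx // => /rowP /(_ i0).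
  by rewrite !mxE eqxx.
rewrite -row_mul !mulmxA mulVmx // mul1mx row_mul.
suff -> : forall N : 'M[int]_(m, n), (forall j, N i0 j = 0) -> row i0 N = 0.
- by rewrite mul0mx.
- move=> j; rewrite !mxE; case: eqP => // /= E.
  have := ltn_ord j; rewrite -E /= => /leq_trans.
  move=> /(_ n (leqnn _)).
  by rewrite ltnNge -ltnS prednK ?ltnm // (leq_ltn_trans _ ltnm).
- by move=> N N0; apply/rowP => j; rewrite !mxE N0.
Qed.

(** Brings linear combinations with different supports to a common one. *)
Lemma sum_coef_widen (G : zmodType) (A D : {fset G}) (F : G -> G)
    (c : G -> int) :
  (A `<=` D)%fset ->
  \sum_(x <- A) F x *~ c x = \sum_(x <- D) F x *~ (if x \in A then c x else 0).
Proof.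
move=> AD; rewrite -[RHS](@big_fset_incl _ _ _ _ A) //.
  by apply: eq_big_seq => x ->.
by move=> x _ /negPf ->; rewrite mulr0z.
Qed.

(** * Free abelian groups *)

(** Universal property of a basis.  Instead of coordinates, the proof uses the
    relation between a combination of basis elements and the same combination of
    their images: it is total because B generates, and closed under differences,
    so that it is functional as soon as 0 is only related to 0, which follows
    from the independence of B. *)
Lemma basis_extension (G : zmodType) (B : set G) (f : G -> G) :
  z_independent B -> z_generating B ->
  exists phi : {additive G -> G}, forall b, B b -> phi b = f b.
Proof.
move=> Bind Bgen.
pose rel y z := exists (A : {fset G}) (c : G -> int),
  [/\ [set` A] `<=` B, y = \sum_(x <- A) x *~ c x
    & z = \sum_(x <- A) f x *~ c x].
have relB y z y' z' : rel y z -> rel y' z' -> rel (y - y') (z - z').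
  move=> [A [c [AB -> ->]]] [A' [c' [AB' -> ->]]].
  exists (A `|` A')%fset.
  exists (fun x =>
    (if x \in A then c x else 0) - (if x \in A' then c' x else 0)).
  split; first by move=> x /=; rewrite inE => /orP[/AB|/AB'].
    rewrite (sum_coef_widen id c (fsubsetUl A A')).
    rewrite (sum_coef_widen id c' (fsubsetUr A A')) -sumrB.
    by apply: eq_bigr => x _; rewrite mulrzBr.
  rewrite (sum_coef_widen f c (fsubsetUl A A')).
  rewrite (sum_coef_widen f c' (fsubsetUr A A')) -sumrB.
  by apply: eq_bigr => x _; rewrite mulrzBr.
have rel0 z : rel 0 z -> z = 0.
  move=> [A [c [AB /esym y0 ->]]]; rewrite big_seq big1 // => x xA.
  by rewrite (Bind A c AB y0) // mulr0z.
have relf y z z' : rel y z -> rel y z' -> z = z'.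
  move=> yz yz'; apply/eqP; rewrite -subr_eq0; apply/eqP/rel0.
  by rewrite -(subrr y); exact: relB.
have relT y : exists z, rel y z.
  have [A [c [AB ->]]] := Bgen y.
  by exists (\sum_(x <- A) f x *~ c x), A, c.
pose phi y := projT1 (cid (relT y)).
have phiP y : rel y (phi y) by rewrite /phi; case: cid.
have phi_add : zmod_morphism phi.
  by move=> x y; apply: relf (phiP _) _; exact: relB.
pose phiM := GRing.isZmodMorphism.Build G G phi phi_add.
pose phiA : {additive G -> G} := HB.pack phi phiM.
exists phiA => b Bb; apply: relf (phiP b) _.
exists [fset b]%fset, (fun=> 1); split.
- by move=> x /=; rewrite inE => /eqP ->.
- by rewrite big_seq_fset1 mulr1z.
- by rewrite big_seq_fset1 mulr1z.
Qed.

Lemma free_torsion_free (G : zmodType) (B : set G) (x : G) (n : int) :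
  z_independent B -> z_generating B -> x *~ n = 0 -> n != 0 -> x = 0.
Proof.
move=> Bind Bgen; have [A [c [AB ->]]] := Bgen x => xn0 n0.
rewrite big_seq big1 // => y yA.
suff -> : c y = 0 by rewrite mulr0z.
have /(_ y yA) : forall y, y \in A -> c y * n = 0.
  apply: Bind AB _; rewrite -[RHS]xn0 mulrz_suml.
  by apply: eq_bigr => z _; rewrite mulrzA.
by move=> /eqP; rewrite mulf_eq0 (negPf n0) orbF => /eqP.
Qed.

(** The coefficients of the elements of D on A form a matrix whose left kernel
    gives relations between these elements. *)
Lemma independent_card_le (G : zmodType) (A D : {fset G}) :
  z_generating [set` A] -> z_independent [set` D] -> (#|` D| <= #|` A|)%N.
Proof.
move=> Agen Dind; rewrite leqNgt; apply/negP => ltAD.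
have coefP y : exists c : G -> int, y = \sum_(x <- A) x *~ c x.
  have [A' [c [sA' ->]]] := Agen y.
  exists (fun x => if x \in A' then c x else 0).
  by apply: (sum_coef_widen id); apply/fsubsetP.
pose c y := projT1 (cid (coefP y)).
have cE y : y = \sum_(x <- A) x *~ c y x by rewrite /c; case: cid.
pose a i := nth 0 (enum_fset A) i.
pose e i := nth 0 (enum_fset D) i.
have [u u0 uM] := int_left_kernel (\matrix_(i, j) c (e i) (a j)) ltAD.
pose v x : int := if insub (index x (enum_fset D)) is Some i then u 0 i else 0.
have ve (i : 'I_#|` D|) : v (e i) = u 0 i.
  rewrite /v /e index_uniq ?fset_uniq //.
  by rewrite valK.
have sum0 : \sum_(x <- D) x *~ v x = 0.
  rewrite (big_nth 0) big_mkord.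
  under eq_bigr => i _.
    rewrite -/(e i) ve [X in X *~ _]cE mulrz_suml (big_nth 0) big_mkord.
    under eq_bigr => j _ do rewrite -/(a j) -mulrzA.
    over.
  rewrite exchange_big /= big1 // => j _.
  rewrite -mulrz_sumr.
  move/rowP: uM => /(_ j); rewrite !mxE => uM.
  transitivity (a j *~ 0); last by rewrite mulr0z.
  congr (_ *~ _); apply: etrans uM.
  by apply: eq_bigr => i _; rewrite !mxE mulrC.
move/eqP: u0; apply; apply/rowP => i; rewrite mxE -ve.
by apply: (Dind D v) => //; rewrite mem_nth.
Qed.

(** * Cardinalities and the torsion-free rank *)

Lemma counting_infinite (T : choiceType) (R : realType) (X : set T) :
  infinite_set X -> counting X = +oo%E :> \bar R.
Proof. by move=> Xinf; rewrite /counting asboolF. Qed.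

Lemma counting_finite (T : choiceType) (R : realType) (X : {fset T}) :
  counting [set` X] = (#|` X|%:R)%:E :> \bar R.
Proof. by rewrite /counting asboolT ?set_fsetK //; exact: finite_fset. Qed.

(** An infinite independent set contains finite subsets of any size, so that the
    bound for finite independent sets also excludes it next to a finite
    basis. *)
Lemma torsion_free_rank_basis (R : realType) (G : zmodType) (B : set G) :
  z_independent B -> z_generating B -> torsion_free_rank R G = counting B.
Proof.
move=> Bind Bgen; apply/eqP; rewrite eq_le; apply/andP; split; last first.
  by apply: ereal_sup_ubound; exists B.
apply/ereal_supP => _ [C Cind <-].
have [/finite_fsetP [A BA]|/(@counting_infinite _ R) ->] :=
  pselect (finite_set B); last exact: leey.
have Cle (D : {fset G}) : [set` D] `<=` C -> (#|` D| <= #|` A|)%N.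
  move=> DC; apply: independent_card_le; first by rewrite -BA.
  by move=> E c ED; apply: Cind; exact: subset_trans ED DC.
have [/finite_fsetP [D CD]|/infinite_set_fset Cinf] := pselect (finite_set C).
  by rewrite BA CD !counting_finite lee_fin ler_nat Cle // CD.
by have [D /Cle DA] := Cinf #|` A|.+1; rewrite ltnNge DA.
Qed.

Lemma counting_le1 (T : choiceType) (R : realType) (X : set T) :
  (counting X <= 1 :> \bar R)%E <-> is_subset1 X.
Proof.
split=> [|X1].
  have [/finite_fsetP [A ->]|/(@counting_infinite _ R) ->] :=
    pselect (finite_set X) => //.
  rewrite counting_finite lee_fin lern1 => A1 x y /= xA yA.
  apply/eqP/negPn/negP => xy.
  have : (#|` [fset x; y]%fset| <= #|` A|)%N.
    apply: fsubset_leq_card; apply/fsubsetP => u.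
    by rewrite !inE => /orP[/eqP->|/eqP->].
  by rewrite cardfs2 xy leqNgt ltnS A1.
have [->|/set0P[x Xx]] := eqVneq X set0.
  by rewrite -set_fset0 counting_finite cardfs0 lee_fin.
have -> : X = [set` [fset x]%fset].
  apply/seteqP; split=> [y /X1 /(_ Xx) ->|y /=]; rewrite /= inE //.
  by move=> /eqP ->.
by rewrite counting_finite cardfs1.
Qed.

(** * Endomorphisms and strings *)

Lemma infinite_range (T : Type) (u : nat -> T) :
  injective u -> infinite_set (range u).
Proof.
move=> u_inj; have u_card : (range u #= [set: nat])%card.
  by apply: inj_card_eq; exact: in2W.
by rewrite (eq_finite_set u_card); exact: infinite_nat.
Qed.

(** In a cyclic group phi is multiplication by some integer m, so that the
    coordinates of a string would have non-increasing absolute values; they are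
    well defined by the last hypothesis once b is nonzero. *)
Lemma cyclic_no_string (G : zmodType) (b : G) (phi : {additive G -> G})
    (S : nat -> G) :
  (forall y, exists c : int, y = b *~ c) ->
  (forall n : int, b *~ n = 0 -> n != 0 -> b = 0) ->
  ~ is_string phi S.
Proof.
move=> bgen btf [Sinj phiS].
have b0 : b != 0.
  apply/eqP => b0; have [c S0] := bgen (S 0%N); have [c' S1] := bgen (S 1%N).
  suff /Sinj : S 0%N = S 1%N by [].
  by rewrite S0 S1 b0 !mul0rz.
have bI (p q : int) : b *~ p = b *~ q -> p = q.
  move=> pq; apply/eqP; rewrite -subr_eq0; apply/negPn/negP => /btf bE.
  by move/eqP: b0; apply; apply: bE; rewrite mulrzBr pq subrr.
have [m phib] := bgen (phi b).
pose c n := projT1 (cid (bgen (S n))).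
have cE n : S n = b *~ c n by rewrite /c; case: cid.
have c_inj : injective c by move=> i j ij; apply: Sinj; rewrite !cE ij.
have cS n : c n = m * c n.+1.
  by apply: bI; rewrite -cE -phiS cE raddfMz phib mulrzA.
have c_le n : `|c n| <= `|c 0%N|.
  elim: n => // n; apply: le_trans.
  have [m0|m0] := eqVneq m 0.
    suff /c_inj : c 0%N = c 1%N by [].
    by rewrite (cS 0%N) (cS 1%N) m0 !mul0r.
  by rewrite (cS n) normrM ler_peMl // -gtz0_ge1 normr_gt0.
(* Shifting by the bound N turns c into an injective bounded sequence of natural
   numbers. *)
move: (`|c 0%N|) c_le => N c_le.
have cN n : 0 <= c n + N <= N + N.
  by rewrite -lerBlDr sub0r lerD2r -ler_norml.
have cN0 n : `|c n + N| = c n + N by rewrite ger0_norm //; have /andP[] := cN n.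
pose g n := absz (c n + N)%R.
have g_inj : injective g.
  by move=> i j /(congr1 Posz); rewrite !abszE !cN0 => /addIr /c_inj.
have [n] := injective_gtn g_inj (absz (N + N)%R).
rewrite ltnNge -lez_nat !abszE cN0 => /negP; apply.
by have /andP[_ le2N] := cN n; exact: le_trans le2N (ler_norm _).
Qed.

(** Once moved so as to start in the kernel of phi, a null string behaves like
    basis vectors under a backward shift: the powers of phi separate its
    terms. *)
Lemma null_string_independent (G : zmodType) (phi : {additive G -> G})
    (S : nat -> G) :
  (forall (x : G) (n : int), x *~ n = 0 -> n != 0 -> x = 0) ->
  is_null_string phi S -> exists2 C : set G, z_independent C & infinite_set C.
Proof.
move=> tf [[Sinj phiS] S0 [k [k0 phik]]].
(* The last nonzero iterate of S 0 lies in the kernel of phi, and so S is moved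
   by phi^l to a string z that starts in this kernel. *)
have [l [zl phil]] :
    exists l, iter l phi (S 0%N) <> 0 /\ iter l.+1 phi (S 0%N) = 0.
  elim: k {k0} phik => [//|k IH] phik.
  by have [/IH//|] := pselect (iter k phi (S 0%N) = 0); exists k.
pose z n := iter l phi (S n).
have phiz n : phi (z n.+1) = z n by rewrite /z -iterS iterSr phiS.
have phiz0 : phi (z 0%N) = 0 by rewrite /z -iterS.
have iterD i : {morph iter i phi : x y / x + y}.
  by elim: i => // i IH x y; rewrite !iterS IH raddfD.
have iter0 i : iter i phi 0 = 0 by elim: i => // i /= ->; rewrite raddf0.
have iterMz i x (n : int) : iter i phi (x *~ n) = iter i phi x *~ n.
  by elim: i => // i /= ->; rewrite raddfMz.
have iterz i n : iter i phi (z n) = if (i <= n)%N then z (n - i)%N else 0.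
  elim: i => [|i IH] in n *; first by rewrite subn0.
  rewrite iterSr; case: n => [|n]; first by rewrite phiz0 iter0.
  by rewrite phiz IH ltnS subSS.
have z_inj : injective z.
  move=> i j; wlog ij : i j / (i <= j)%N.
    by move=> wl zij; case/orP: (leq_total i j) => le; [|symmetry]; apply: wl.
  move=> zij; apply/eqP; rewrite eqn_leq ij /= leqNgt; apply/negP => ltij.
  have := iterz j i; rewrite leqNgt ltij /= zij iterz leqnn subnn.
  exact: zl.
exists (range z); last exact: infinite_range.
move=> A c Az sum0.
(* The coefficients vanish by descending induction on the index: once those of
   index above n are known to vanish, phi^n leaves only c (z n) z_0 of the
   relation. *)
pose N := \max_(x <- A) xget 0%N [set n | z n = x].
have Az' x : x \in A -> exists2 n, (n <= N)%N & z n = x.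
  move=> xA; exists (xget 0%N [set n | z n = x]).
    by rewrite /N; apply: leq_bigmax_seq.
  have [n _ zn] := Az x xA.
  by apply: (@xgetPex _ 0%N [set n | z n = x]); exists n.
suff cz n : z n \in A -> c (z n) = 0.
  by move=> x xA; have [n _ zn] := Az' x xA; rewrite -zn cz // zn.
have [p] := ubnP (N.+1 - n)%N; elim: p => // p IH in n * => ltp znA.
have iter_sum : iter n phi (\sum_(x <- A) x *~ c x) =
    \sum_(x <- A) iter n phi x *~ c x.
  rewrite (big_morph _ (iterD n) (iter0 n)).
  by apply: eq_bigr => x _; rewrite iterMz.
move: iter_sum; rewrite sum0 iter0.
rewrite (big_fsetD1 _ znA) /= iterz leqnn subnn big_seq big1 ?addr0.
  move=> /esym zc; apply/eqP/negPn/negP => cn0; exact: zl (tf _ _ zc cn0).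
move=> x; rewrite !inE => /andP[xn xA].
have [q qN zq] := Az' x xA; rewrite -zq.
have [nq|qn] := leqP n q; last by rewrite iterz leqNgt qn mul0rz.
rewrite IH ?mulr0z ?zq //.
have {}nq : (n < q)%N.
  by rewrite ltn_neqAle nq andbT; apply: contra_neq xn => ->.
apply: leq_trans (ltp : (N.+1 - n <= p)%N); apply: ltn_sub2l => //.
by rewrite ltnS (leq_trans _ qN) // ltnW.
Qed.

(** The unipotent map f |-> f + e, e |-> e has infinite backward and forward
    orbits through every nonzero multiple of f. *)
Lemma shear_strings (G : zmodType) (B : set G) :
  z_independent B -> z_generating B -> ~ is_subset1 B ->
  exists (phi : {additive G -> G}) (S : nat -> nat -> G),
    (forall k, is_nonsingular_string phi (S k)) /\
    (forall k n l m, S k n = S l m -> k = l).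
Proof.
move=> Bind Bgen; rewrite /is_subset1 => /existsNP [e] /existsNP [f].
move=> /not_implyP [Be] /not_implyP [Bf] /eqP nef.
pose shear b := if b == f then f + e else b.
have [phi phiE] := basis_extension shear Bind Bgen.
have phie : phi e = e by rewrite phiE // /shear (negPf nef).
have phif : phi f = f + e by rewrite phiE // /shear eqxx.
have efI (a b a' b' : int) :
    f *~ a - e *~ b = f *~ a' - e *~ b' -> a = a' /\ b = b'.
  move=> E; pose c x := if x == f then a - a' else b' - b.
  have efB : [set` [fset e; f]%fset] `<=` B.
    by move=> x /=; rewrite !inE => /orP[/eqP ->|/eqP ->].
  have ce : \sum_(x <- [fset e; f]%fset) x *~ c x = 0.
    rewrite big_fsetU1 /=; last by rewrite inE.
    rewrite big_seq_fset1 /c eqxx (negPf nef) !mulrzBr.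
    apply/eqP; rewrite addrC addr_eq0 opprB subr_eq.
    by move/eqP: E; rewrite subr_eq => /eqP ->; rewrite addrAC -addrA addrC.
  have := Bind _ _ efB ce f; have := Bind _ _ efB ce e.
  rewrite /c !inE !eqxx (negPf nef) orbT /= => /(_ isT) /eqP + /(_ isT) /eqP.
  by rewrite !subr_eq0 => /eqP -> /eqP ->.
(* S k is the backward orbit of (k+1) f: different orbits are told apart by the
   coordinate on f, and the terms of one orbit by the coordinate on e, the
   multiple k+1 of f being nonzero. *)
pose S k n : G := f *~ k.+1%:Z - e *~ (n * k.+1)%N%:Z.
have SI k n l m : S k n = S l m -> k = l /\ n = m.
  by move=> /efI[[<-] [/eqP]]; rewrite eqn_pmul2r // => /eqP.
exists phi, S; split=> [k|k n l m /SI[]//].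
have Sinj : injective (S k) by move=> n m /SI[].
have phiS n : phi (S k n.+1) = S k n.
  rewrite /S raddfB !(raddfMz phi) phie phif mulrzDl -addrA; congr (_ + _).
  by rewrite mulSn PoszD mulrzDr opprD addrA subrr sub0r.
split=> // -[_ [i [j [ij]]]].
have iterS p : iter p phi (S k 0%N) = f *~ k.+1%:Z - e *~ (- (p * k.+1)%N%:Z).
  elim: p => [|p /= ->]; first by rewrite /S mul0n oppr0.
  rewrite raddfB !(raddfMz phi) phie phif mulrzDl -addrA; congr (_ + _).
  by rewrite mulSn PoszD opprD mulrzDr opprD !mulrNz !opprK.
rewrite !iterS => /efI[_ /oppr_inj [/eqP]].
by rewrite eqn_pmul2r // => /eqP.
Qed.

Lemma infinite_basis_shift (G : zmodType) (B : set G) :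
  z_independent B -> z_generating B -> infinite_set B ->
  exists (phi : {additive G -> G}) (S : nat -> G), is_null_string phi S.
Proof.
move=> Bind Bgen /infiniteP /card_leP [h].
pose e n : G := val (h (to_setT n)).
have eB n : B (e n) by apply: set_valP.
have e_inj : injective e.
  by move=> i j /val_inj /(inj (mem_set I) (mem_set I)) /(congr1 val).
pose f b :=
  if pselect (exists n, b = e n.+1) is left H then e (projT1 (cid H)) else 0.
have [phi phiE] := basis_extension f Bind Bgen.
exists phi, e; split.
- split=> // n; rewrite phiE // /f; case: pselect => [H|[]]; last by exists n.
  by case: cid => m /= /e_inj [->].
- move=> e0.
  have e0B : [set` [fset e 0%N]%fset] `<=` B.
    by move=> x /=; rewrite inE => /eqP ->.
  have := Bind [fset e 0%N]%fset (fun=> 1) e0B.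
  rewrite big_seq_fset1 mulr1z => /(_ e0 (e 0%N)).
  by rewrite inE eqxx => /(_ isT).
- exists 1%N; split=> //=; rewrite phiE // /f.
  by case: pselect => // e0; have [n /e_inj] := e0.
Qed.

(** * Suprema over families of disjoint strings *)

Lemma sup_family_ge0 (R : realType) (G : zmodType) (P : set (nat -> G)) :
  (0 <= ereal_sup [set counting F | F in disjoint_family P] :> \bar R)%E.
Proof.
apply: le_ereal_sup_tmp; exists 0%E => //; exists set0.
  by split=> // S S' [].
by rewrite -set_fset0 counting_finite cardfs0.
Qed.

Lemma sup_family_eq0 (R : realType) (G : zmodType) (P : set (nat -> G)) :
  ereal_sup [set counting F | F in disjoint_family P] = 0%E :> \bar R <->
  forall S, ~ P S.
Proof.
split=> [sup0 S PS|nP].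
  suff : (1 <= 0 :> \bar R)%E by rewrite lee_fin ler10.
  rewrite -sup0; apply: le_ereal_sup_tmp; exists 1%E => //.
  exists [set` [fset S]%fset]; last by rewrite counting_finite cardfs1.
  split; first by move=> S' /=; rewrite inE => /eqP ->.
  by move=> S1 S2 /fset1P -> /fset1P ->.
apply/eqP; rewrite eq_le sup_family_ge0 andbT.
apply/ereal_supP => _ [F [FP _] <-].
have -> : F = set0 by rewrite -subset0 => S /FP /nP.
by rewrite -set_fset0 counting_finite cardfs0.
Qed.

Lemma sup_family_infinite (R : realType) (G : zmodType) (P : set (nat -> G))
    (S : nat -> nat -> G) :
  (forall k, P (S k)) ->
  (forall k n l m, S k n = S l m -> k = l) ->
  ereal_sup [set counting F | F in disjoint_family P] = +oo%E :> \bar R.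
Proof.
move=> PS Sdisj; apply/eqP; rewrite eq_le leey /=; apply: ereal_sup_ubound.
exists (range S).
  split; first by move=> _ [k _ <-].
  move=> _ _ [k _ <-] [l _ <-] [x [[n _ <-] [m _ /Sdisj ->]]] //.
apply: counting_infinite.
apply: infinite_range => k l kl.
by apply: (Sdisj k 0%N l 0%N); rewrite kl.
Qed.

(** Stated for any class of strings, as it serves both the strings of (a) and (b)
    and the null strings of (c): a single string already is a disjoint family. *)
Lemma sup_end_eq0 (R : realType) (G : zmodType)
    (P : {additive G -> G} -> set (nat -> G)) :
  ereal_sup [set ereal_sup [set counting F | F in disjoint_family (P phi)]
    | phi in [set: {additive G -> G}]] = 0%E :> \bar R <->
  forall phi S, ~ P phi S.
Proof.
split=> [sup0 phi|nP].
  apply/(sup_family_eq0 R)/eqP; rewrite eq_le sup_family_ge0 andbT -sup0.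
  by apply: ereal_sup_ubound; exists phi.
apply/eqP; rewrite eq_le; apply/andP; split.
  apply/ereal_supP => _ [phi _ <-].
  by have /(sup_family_eq0 R) -> := nP phi.
have := @sup_family_ge0 R G (P \0) => /le_trans; apply.
by apply: ereal_sup_ubound; exists \0.
Qed.

(** * Strings of free abelian groups *)

Theorem corollary2p11 (R : realType) (G : zmodType) (hG : free_abelian G) :
  [/\ s_group R G = ns_group R G,
      s_group R G = 0%E <-> (torsion_free_rank R G <= 1)%E
    & s0_group R G = 0%E <-> (torsion_free_rank R G < +oo)%E].
Proof.
have [B [Bind Bgen]] := hG.
rewrite (torsion_free_rank_basis R Bind Bgen).
have tf (x : G) (n : int) : x *~ n = 0 -> n != 0 -> x = 0.
  exact: free_torsion_free Bind Bgen.
have no_string : is_subset1 B -> forall phi S, ~ @is_string G phi S.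
  move=> B1 phi S.
  have [b Bb] : exists b : G, B `<=` [set b].
    have [->|/set0P[b Bb]] := eqVneq B set0; first by exists 0.
    by exists b => x /B1 /(_ Bb).
  apply: (@cyclic_no_string _ b) => [y|n]; last exact: tf.
  have [A [c [AB ->]]] := Bgen y.
  exists (\sum_(x <- A) c x); rewrite mulrz_sumr.
  by apply: eq_big_seq => x /AB /Bb ->.
have ns_infinite :
    ~ is_subset1 B -> ns_group R G = +oo%E /\ s_group R G = +oo%E.
  move=> /(shear_strings Bind Bgen)[phi [S [Sns Sdisj]]].
  split; apply/eqP; rewrite eq_le leey /=; apply: le_ereal_sup_tmp.
    exists +oo%E => //; exists phi => //; exact: sup_family_infinite Sns Sdisj.
  exists +oo%E => //; exists phi => //.
  by apply: sup_family_infinite Sdisj => k; have [] := Sns k.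
have s0P : s_group R G = 0%E <-> is_subset1 B.
  split=> [s0|B1]; last by apply/sup_end_eq0; exact: no_string.
  by apply: contrapT => /ns_infinite[_]; rewrite s0.
split.
- have [B1|/ns_infinite[-> ->]//] := pselect (is_subset1 B).
  rewrite (s0P.2 B1); symmetry; apply/(sup_end_eq0 R) => phi S [].
  by move=> /(no_string B1).
- by rewrite s0P counting_le1.
- transitivity (finite_set B); last first.
    split=> [/finite_fsetP[A ->]|]; first by rewrite counting_finite ltry.
    by apply: contraPP => /(@counting_infinite _ R) ->.
  split=> [/sup_end_eq0 no_null|finB].
    apply: contrapT => /(infinite_basis_shift Bind Bgen)[phi [S]].
    exact: no_null.
  apply/(sup_end_eq0 R) => phi S /(null_string_independent tf)[C Cind Cinf].
  have : (counting C <= torsion_free_rank R G)%E.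
    by apply: ereal_sup_ubound; exists C.
  rewrite (torsion_free_rank_basis R Bind Bgen) (counting_infinite R Cinf).
  by have /finite_fsetP[A ->] := finB; rewrite counting_finite leNgt ltry.
Qed.
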